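(* For every unsatisfiable clause-set $F$ we have $\mathrm{whd}(F)\le\mathrm{ss}(F)$.
   Context: Literals are variables $v$ or negations $\overline{v}$; clauses are finite sets of literals without complementary pair; clause-sets are finite sets of clauses; $\bot$ empty clause, $\top$ empty clause-set, $c(F)$ number of clauses. A partial assignment $\varphi$ maps finitely many variables to $\{0,1\}$; $\varphi*F$ removes satisfied clauses and false literals. $F$ is satisfiable iff $\varphi*F=\top$ for some $\varphi$; $F\models G$ iff every $\varphi$ with $\varphi*F=\top$ has $\varphi*G=\top$. Resolution: clauses $C,D$ with exactly one clashing literal $x\in C,\overline{x}\in D$ have resolvent $(C\cup D)\setminus\{x,\overline{x}\}$. A resolution tree is a finite rooted tree, inner nodes with exactly two children, nodes labelled by clauses, each inner label the resolvent of its children's labels; a refutation of $F$ has leaf labels in $F$ and root label $\bot$. Asymmetric width: $\mathrm{whd}(T)=0$ for a single node; otherwise, with root children labelled $C_1,C_2$ and subtrees $T_1,T_2$, $\mathrm{whd}(T)=\max(\mathrm{whd}(T_1),\mathrm{whd}(T_2),\min(|C_1|,|C_2|))$; $\mathrm{whd}(F)$ is the minimum over refutations of $F$. Semantic $k$-sequence for $F$: $F_1,\dots,F_p$ with $c(F_i)\le k$, $F_1=\top$, and each $F_i$ ($i\ge2$) obtained either by $F_{i-1}\models F_i$ or as $F_{i-1}\cup\{C\}$ with $C\in F$; complete if $F_p$ is unsatisfiable. $\mathrm{ss}(F)$ is the least $k\in\mathbb{N}$ admitting a complete semantic $k$-sequence for $F$. *)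

(* Defs.v *)
From HB Require Import structures.
From mathcomp Require Import all_boot finmap.
From mathcomp Require Import boolp.

Set Implicit Arguments.
Unset Strict Implicit.
Unset Printing Implicit Defensive.

Local Open Scope fset_scope.
Local Open Scope fmap_scope.

(* (v, true) is the literal v and (v, false) is its negation. *)
Notation literal V := (V * bool)%type.

Section ClauseSets.
Variable V : choiceType.

Local Notation lit := (literal V).

Definition lneg (x : lit) : lit := (x.1, ~~ x.2).

Record clause := Clause {
  lits :> {fset lit};
  _ : [disjoint lits & lneg @` lits]
}.
HB.instance Definition _ := [isSub for lits].
HB.instance Definition _ := [Choice of clause by <:].

Local Notation clause_set := {fset clause}.
Local Notation assignment := {fmap V -> bool}.

Definition lit_true (phi : assignment) (x : lit) : bool :=
  phi.[? x.1] == Some x.2.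
Definition lit_false (phi : assignment) (x : lit) : bool :=
  phi.[? x.1] == Some (~~ x.2).

Definition clause_sat (phi : assignment) (C : clause) : bool :=
  [exists x : lits C, lit_true phi (val x)].

Lemma clauseP (C : clause) x : x \in lits C -> lneg x \notin lits C.
Proof.
case: C => A /= /fdisjointP dA xA; apply/negP => nxA.
by have /negP := dA _ nxA; apply; apply/imfsetP; exists x.
Qed.

Lemma compl_free (A : {fset lit}) :
  (forall x, x \in A -> lneg x \notin A) -> [disjoint A & lneg @` A].
Proof.
move=> h; apply/fdisjointP => y yA; apply/negP => /imfsetP[x /= xA e].
by have := h _ xA; rewrite -e yA.
Qed.

Lemma restrict_subproof (phi : assignment) (C : clause) :
  [disjoint [fset x in lits C | ~~ lit_false phi x]
   & lneg @` [fset x in lits C | ~~ lit_false phi x]].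
Proof.
apply: compl_free => x; rewrite !inE /= => /andP[xC _].
by rewrite (negPf (clauseP xC)).
Qed.

Definition restrict (phi : assignment) (C : clause) : clause :=
  Clause (restrict_subproof phi C).

(* phi * F *)
Definition apply_assignment (phi : assignment) (F : clause_set) : clause_set :=
  [fset restrict phi C | C in F & ~~ clause_sat phi C].

Definition satisfiable (F : clause_set) : Prop :=
  exists phi, apply_assignment phi F = fset0.
Definition unsatisfiable (F : clause_set) : Prop := ~ satisfiable F.

Definition entails (F G : clause_set) : Prop :=
  forall phi, apply_assignment phi F = fset0 -> apply_assignment phi G = fset0.

Definition resolvent (C D R : clause) : Prop :=
  exists x : lit,
    [fset y in lits C | lneg y \in lits D] = [fset x] /\
    lits R = (lits C `|` lits D) `\` [fset x; lneg x].

Inductive rtree :=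
  | RLeaf of clause
  | RNode of clause & rtree & rtree.

Definition label (T : rtree) : clause :=
  match T with RLeaf C => C | RNode C _ _ => C end.

Fixpoint resolution_tree (T : rtree) : Prop :=
  match T with
  | RLeaf _ => True
  | RNode C T1 T2 =>
      [/\ resolvent (label T1) (label T2) C,
          resolution_tree T1 & resolution_tree T2]
  end.

Fixpoint leaves (T : rtree) : seq clause :=
  match T with
  | RLeaf C => [:: C]
  | RNode _ T1 T2 => leaves T1 ++ leaves T2
  end.

Definition refutation (F : clause_set) (T : rtree) : Prop :=
  [/\ resolution_tree T, {subset leaves T <= F} & lits (label T) = fset0].

Fixpoint tree_whd (T : rtree) : nat :=
  match T with
  | RLeaf _ => 0
  | RNode _ T1 T2 =>
      maxn (maxn (tree_whd T1) (tree_whd T2))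
           (minn #|` lits (label T1)| #|` lits (label T2)|)
  end.

Definition semantic_step (F G H : clause_set) : Prop :=
  entails G H \/ exists2 C, C \in F & H = C |` G.

(* The sequence F_1, ..., F_p is stored as s = [:: F_1; ...; F_p], so that F_i
   is the entry of s at index i - 1. *)
Definition semantic_sequence (F : clause_set) (k : nat) (s : seq clause_set)
    : Prop :=
  [/\ 0 < size s,
      nth fset0 s 0 = fset0,
      forall G, G \in s -> #|` G| <= k
    & forall i, i.+1 < size s ->
        semantic_step F (nth fset0 s i) (nth fset0 s i.+1)].

Definition complete_semantic_sequence (F : clause_set) (k : nat)
    (s : seq clause_set) : Prop :=
  semantic_sequence F k s /\ unsatisfiable (last fset0 s).

Lemma apply_eq0P (phi : assignment) (F : clause_set) :
  apply_assignment phi F = fset0 <-> {in F, forall C, clause_sat phi C}.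
Proof.
split=> [e C CF | h].
  apply: contraT => nC.
  suff : restrict phi C \in apply_assignment phi F by rewrite e inE.
  by apply/imfsetP; exists C => //=; rewrite !inE CF.
apply/fsetP => C; rewrite inE; apply/negP => /imfsetP[D /=].
by rewrite !inE => /andP[DF]; rewrite (h D DF).
Qed.

Lemma lit_falseW (phi : assignment) (v : V) (b : bool) (x : lit) :
  lit_false phi.[v <- b] x -> x != (v, ~~ b) -> lit_false phi x.
Proof.
case: x => w c; rewrite /lit_false /= fnd_set xpair_eqE.
by case: (eqVneq w v) => //= _; case: b; case: c.
Qed.

Lemma falsified_tree (F : clause_set) (vs : seq V) (phi : assignment) :
  unsatisfiable F ->
  (forall C x, C \in F -> x \in lits C -> (x.1 \in vs) || (x.1 \in phi)) ->
  exists T, [/\ resolution_tree T, {subset leaves T <= F}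
              & forall x, x \in lits (label T) -> lit_false phi x].
Proof.
move=> unsF; elim: vs phi => [|v vs IH] phi hv.
  have [C CF nC] : exists2 C, C \in F & ~~ clause_sat phi C.
    apply: contrapT => h; apply: unsF; exists phi; apply/apply_eq0P => C CF.
    by apply: contrapT => /negP nC; apply: h; exists C.
  exists (RLeaf C); split=> //= [D|x xC]; first by rewrite inE => /eqP->.
  have /= := hv _ _ CF xC; rewrite -fndSome /lit_false.
  case e: phi.[? x.1] => [b|] //= _.
  move: nC; rewrite /clause_sat negb_exists => /forallP /(_ [` xC]) /=; rewrite /lit_true e.
  by case: (b); case: (x.2).
have hb b : forall C x, C \in F -> x \in lits C ->
    (x.1 \in vs) || (x.1 \in phi.[v <- b]).
  move=> C x CF xC; have := hv _ _ CF xC.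
  by rewrite !inE; case: (x.1 == v); rewrite ?orbT.
have [T0 [r0 l0 f0]] := IH _ (hb false).
have [T1 [r1 l1 f1]] := IH _ (hb true).
have [n0|i0] := boolP ((v, true) \in lits (label T0)); last first.
  exists T0; split=> // x xT; apply: lit_falseW (f0 _ xT) _ => /=.
  by apply: contraNneq i0 => <-.
have [n1|i1] := boolP ((v, false) \in lits (label T1)); last first.
  exists T1; split=> // x xT; apply: lit_falseW (f1 _ xT) _ => /=.
  by apply: contraNneq i1 => <-.
pose A := (lits (label T0) `|` lits (label T1))
            `\` [fset ((v, true) : lit); lneg (v, true)].
have fA x : x \in A -> lit_false phi x.
  rewrite !inE negb_or => /andP[/andP[nx1 nx2] /orP[] xT].
    exact: lit_falseW (f0 _ xT) nx1.
  exact: lit_falseW (f1 _ xT) nx2.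
have dA : [disjoint A & lneg @` A].
  apply: compl_free => x /fA fx; apply/negP => /fA.
  by move/eqP: fx; rewrite /lit_false /= => -> /eqP[]; case: (x.2).
exists (RNode (Clause dA) T0 T1); split=> //=; last first.
  by move=> C; rewrite mem_cat => /orP[/l0|/l1].
split=> //; exists (v, true); split=> //; apply/fsetP => y; rewrite !inE /=.
apply/andP/eqP => [[y0 y1]|->]; last by [].
apply: contrapT => /eqP ny.
have g0 := lit_falseW (f0 _ y0) ny.
have [e|ny'] := eqVneq (lneg y) (v, false).
  by move: ny e; case: (y) => w [] //= ny [e]; rewrite e eqxx in ny.
have g1 := lit_falseW (f1 _ y1) ny'.
by move/eqP: g0 g1; rewrite /lit_false /= => -> /eqP[]; case: (y.2).
Qed.

Lemma refutation_exists (F : clause_set) : unsatisfiable F ->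
  exists n, `[< exists2 T, refutation F T & tree_whd T = n >].
Proof.
move=> unsF.
pose vs := flatten [seq [seq x.1 | x <- enum_fset (lits C)]
                   | C <- enum_fset F].
have [C x CF xC|T [rT lT fT]] := @falsified_tree F vs [fmap] unsF.
  apply/orP; left; apply/flattenP.
  exists [seq x.1 | x <- enum_fset (lits C)]; last by apply/mapP; exists x.
  by apply/mapP; exists C.
exists (tree_whd T); apply/asboolP; exists T => //; split=> //.
apply/fsetP => x; rewrite inE; apply/negP => /fT.
by rewrite /lit_false fnd_fmap0.
Qed.

Lemma complete_semantic_sequence_exists (F : clause_set) : unsatisfiable F ->
  exists k, `[< exists s, complete_semantic_sequence F k s >].
Proof.
move=> unsF; exists #|` F|; apply/asboolP.
pose pre i : clause_set := [fset C in take i (enum_fset F)].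
have subF i : pre i `<=` F.
  by apply/fsubsetP => C; rewrite !inE => /mem_take.
exists (mkseq pre (size (enum_fset F)).+1); split; first split.
- by rewrite size_mkseq.
- by rewrite nth_mkseq //; apply/fsetP => C; rewrite /pre take0 !inE.
- by move=> G /mapP[i _ ->]; apply: fsubset_leq_card.
- move=> i; rewrite size_mkseq => hi; rewrite !nth_mkseq //; last exact: ltnW.
  case E: (enum_fset F) => [|C0 s0]; first by move: hi; rewrite E.
  right; exists (nth C0 (enum_fset F) i); first exact: mem_nth.
  apply/fsetP => C; rewrite !inE (take_nth C0) // mem_rcons inE //.
rewrite -nth_last size_mkseq nth_mkseq //=.
suff -> : pre (size (enum_fset F)) = F by [].
by apply/fsetP => C; rewrite /pre take_size !inE.
Qed.

Definition whd (F : clause_set) (unsF : unsatisfiable F) : nat :=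
  ex_minn (refutation_exists unsF).

Definition ss (F : clause_set) (unsF : unsatisfiable F) : nat :=
  ex_minn (complete_semantic_sequence_exists unsF).

End ClauseSets.

(* Main.v *)
Require Import Defs.
From mathcomp Require Import all_boot finmap.
From mathcomp Require Import boolp.

(** Let [k = ss F] and suppose that the empty clause has no resolution
    derivation from [F] of asymmetric width at most [k].  Along a semantic
    [k]-sequence one maintains a partial assignment [phi] that satisfies the
    current clause-set [G], assigns at most [c(G)] variables, and falsifies no
    clause derivable in width [k]; at an unsatisfiable [G] this is absurd.
    For an entailment step one drops from [phi] all but one variable per clause.
    When [C] in [F] is added, some literal [x] of [C] can be made true: if every
    unassigned [x] in [C] were blocked by a derivable [D_x] falsified by
    [phi + x], then [D_x] would contain the negation of [x] and have at most
    [c(G) + 1 <= k] literals, so resolving [C] with all the [D_x] in turn, at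
    width [k] whatever the size of [C], would derive a clause falsified by
    [phi]. *)

Set Implicit Arguments.
Unset Strict Implicit.
Unset Printing Implicit Defensive.

Local Open Scope fset_scope.
Local Open Scope fmap_scope.

Section AsymmetricWidth.
Variable V : choiceType.
Implicit Types (phi psi : {fmap V -> bool}) (x y : literal V) (C D E : clause V).
Implicit Types (F G : {fset clause V}).

Definition satisfies phi G := {in G, forall C, clause_sat phi C}.

Definition falsifies phi C := {in lits C, forall x, lit_false phi x}.

Definition width_derivable F k C : Prop :=
  exists T, [/\ resolution_tree T, {subset leaves T <= F}, label T = C
              & tree_whd T <= k].

Lemma lnegK : involutive (@lneg V).
Proof. by case=> v b; rewrite /lneg /= negbK. Qed.

Lemma lit_false_lneg phi x : lit_false phi (lneg x) = lit_true phi x.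
Proof. by rewrite /lit_false /lit_true /= negbK. Qed.

Lemma lit_trueF phi x : lit_true phi x -> lit_false phi x = false.
Proof.
by case: x => v []; rewrite /lit_true /lit_false => /eqP->.
Qed.

Lemma clause_satP phi C :
  reflect (exists2 x, x \in lits C & lit_true phi x) (clause_sat phi C).
Proof.
apply: (iffP existsP) => [[x tx]|[x xC tx]]; first by exists (val x); rewrite ?fsvalP.
by exists [` xC].
Qed.

Lemma clause_sat_sub phi psi C :
  (forall v b, psi.[? v] = Some b -> phi.[? v] = Some b) ->
  clause_sat psi C -> clause_sat phi C.
Proof.
move=> sub /clause_satP[x xC /eqP tx]; apply/clause_satP.
by exists x => //; apply/eqP/sub.
Qed.

Lemma falsifies_sub phi psi C :
  (forall v b, psi.[? v] = Some b -> phi.[? v] = Some b) ->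
  falsifies psi C -> falsifies phi C.
Proof. by move=> sub fC x /fC /eqP /sub /eqP. Qed.

(** A falsified literal is determined by its variable; the default [true] below is never reached on
    [domf phi]. *)
Lemma falsifies_card phi C : falsifies phi C -> #|` lits C| <= #|` domf phi|.
Proof.
move=> fC.
have sub : lits C `<=` [fset (v, ~~ odflt true phi.[? v]) | v in domf phi].
  apply/fsubsetP => -[v b] /fC /eqP /= e; apply/imfsetP; exists v => /=.
    by rewrite -fndSome e.
  by rewrite e /= negbK.
exact: leq_trans (fsubset_leq_card sub) (leq_imfset_card _ _ _).
Qed.

Lemma small_satisfying_restriction phi G : satisfies phi G ->
  exists psi, [/\ forall v b, psi.[? v] = Some b -> phi.[? v] = Some b,
                  #|` domf psi| <= #|` G| & satisfies psi G].
Proof.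
move=> satG.
have /choice[f fP] : forall C : G,
    exists x, x \in lits (val C) /\ lit_true phi x.
  by move=> C; have /clause_satP[x] := satG _ (valP C); exists x.
pose S := [fset (f C).1 | C : G]; exists phi.[& S]; split.
- by move=> v b; rewrite fnd_restrict; case: ifP.
- apply: (@leq_trans #|` S|).
    by apply: fsubset_leq_card; apply/fsubsetP => v; rewrite mem_restrictf => /andP[].
  apply: leq_trans (leq_imfset_card _ _ _) _.
  by rewrite -cardE cardfE.
move=> C CG; have [xC tx] := fP [` CG]; apply/clause_satP.
exists (f [` CG]) => //; rewrite /lit_true fnd_restrict ifT //.
by apply/imfsetP; exists [` CG].
Qed.

(** A complementary pair in the resolvent would have one literal in [C] and the other in [D], so it
    would be the removed pair. *)
Lemma resolvent_exists C D x :
  [fset y in lits C | lneg y \in lits D] = [fset x] ->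
  exists2 R, resolvent C D R
           & lits R = (lits C `|` lits D) `\` [fset x; lneg x].
Proof.
move=> clash.
have clashP y : y \in lits C -> lneg y \in lits D -> y = x.
  by move=> yC yD; apply/fset1P; rewrite -clash !inE yC.
have dR : let A := (lits C `|` lits D) `\` [fset x; lneg x] in
    [disjoint A & (@lneg V) @` A].
  apply: compl_free => y; rewrite !inE negb_or -andbA => /and3P[y1 y2 yCD].
  apply/negP; rewrite negb_or => /andP[_].
  case/orP: yCD => yX /orP[] nyX.
  - by have := clauseP yX; rewrite nyX.
  - by move: y1; rewrite (clashP y) // eqxx.
  - by move: y2; rewrite -(clashP (lneg y)) ?lnegK ?eqxx.
  - by have := clauseP yX; rewrite nyX.
by exists (Clause dR) => //; exists x.
Qed.

Lemma width_derivable_axiom F k C : C \in F -> width_derivable F k C.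
Proof. by move=> CF; exists (RLeaf C); split=> // D; rewrite inE => /eqP->. Qed.

(** Asymmetric width takes the minimum of the two parent sizes, so [C] may be arbitrarily large. *)
Lemma width_derivable_resolvent F k C D E :
  width_derivable F k C -> width_derivable F k D -> #|` lits D| <= k ->
  resolvent C D E -> width_derivable F k E.
Proof.
move=> [T [rT lT <- wT]] [U [rU lU <- wU]] sD res; exists (RNode E T U).
split=> //= [C'|]; first by rewrite mem_cat => /orP[/lT|/lU].
by rewrite !geq_max wT wU geq_min sD orbT.
Qed.

(** Induction on the number of literals of [C] not falsified by [phi]: resolving with [D] removes
    [x] and brings in only falsified literals. *)
Lemma resolve_to_falsified F k phi C :
  width_derivable F k C ->
  {in lits C, forall x, ~~ lit_true phi x} ->
  {in lits C, forall x, ~~ lit_false phi x -> exists D,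
     [/\ width_derivable F k D, #|` lits D| <= k, lneg x \in lits D
       & {in lits D, forall y, y != lneg x -> lit_false phi y}]} ->
  exists2 E, width_derivable F k E & falsifies phi E.
Proof.
pose open C' := [fset x in lits C' | ~~ lit_false phi x].
have [n] := ubnP #|` open C|; elim: n C => // n IH C ltn dC ntC blocked.
have [o0|[x]] := fset_0Vmem (open C).
  exists C => // x xC; apply: contraT => nf.
  by have := in_fset0 x; rewrite -o0 !inE xC nf.
rewrite !inE => /andP[/= xC nfx].
have [D [dD sD nxD fD]] := blocked x xC nfx.
have clash : [fset y in lits C | lneg y \in lits D] = [fset x].
  apply/fsetP => y; rewrite !inE /=; apply/andP/eqP => [[yC yD]|-> //].
  (* For a second clash [y], the literal [lneg y] of [D] would be false, making [y] a true literal
     of [C]. *)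
  apply: contraNeq (ntC y yC) => neq.
  by rewrite -lit_false_lneg fD // (inj_eq (inv_inj lnegK)).
have [R res eR] := resolvent_exists clash.
have memR y : y \in lits R -> y != x /\ (y \in lits C \/ lit_false phi y).
  rewrite eR !inE negb_or => /andP[/andP[neqx neqnx] /orP[yC|yD]].
    by split=> //; left.
  by split=> //; right; apply: fD.
apply: (IH R) => [||y /memR[_ [/ntC //|fy]]|y /memR[_ [yC|->//]]].
- rewrite -ltnS; apply: leq_trans ltn; rewrite ltnS.
  apply: fproper_ltn_card; rewrite fproperE; apply/andP; split.
    apply/fsubsetP => y; rewrite !inE => /andP[/= /memR[_ [->|->]]] //.
  apply/fsubsetPn; exists x; rewrite !inE /= ?xC //.
  by apply/negP => /andP[/memR[]]; rewrite eqxx.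
- exact: width_derivable_resolvent dC dD sD res.
- by apply/negP => /lit_trueF; rewrite fy.
- exact: blocked.
Qed.

Lemma extend_to_satisfy F k phi C : C \in F -> #|` domf phi| < k ->
  (forall D, width_derivable F k D -> ~ falsifies phi D) ->
  ~~ clause_sat phi C ->
  exists x, [/\ x \in lits C, phi.[? x.1] = None
    & forall D, width_derivable F k D -> ~ falsifies phi.[x.1 <- x.2] D].
Proof.
move=> CF ltk nf nsat; apply: contrapT => none.
have ntC : {in lits C, forall x, ~~ lit_true phi x}.
  by move=> x xC; apply: contra nsat => tx; apply/clause_satP; exists x.
suff [E dE fE] : exists2 E, width_derivable F k E & falsifies phi E.
  exact: nf dE fE.
apply: (resolve_to_falsified (width_derivable_axiom k CF) ntC) => x xC nfx.
have ux : phi.[? x.1] = None.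
  move: (ntC _ xC) nfx; rewrite /lit_true /lit_false.
  by case: phi.[? x.1] => // -[]; case: x.2.
have [D dD fD] : exists2 D, width_derivable F k D & falsifies phi.[x.1 <- x.2] D.
  apply: contrapT => h; apply: none; exists x; split=> // D dD fD.
  by apply: h; exists D.
have restD : {in lits D, forall y, y != lneg x -> lit_false phi y}.
  by move=> y yD neq; apply: lit_falseW (fD _ yD) neq.
exists D; split=> //.
(* [D] is falsified by [phi] plus one variable, so the strict bound [ltk] leaves room for the extra
   literal. *)
- apply: leq_trans (falsifies_card fD) _; rewrite dom_setf.
  by rewrite cardfsU1; apply: leq_trans ltk; rewrite -add1n leq_add2r leq_b1.
(* Without [lneg x], the clause [D] would already be falsified by [phi]. *)
- apply: contraT => nxD; exfalso; apply: (nf D dD) => y yD; apply: restD => //.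
  by apply: contraNneq nxD => <-.
Qed.

Lemma semantic_sequence_assignment F k s :
  semantic_sequence F k s ->
  (forall C, lits C = fset0 -> ~ width_derivable F k C) ->
  forall i, i < size s -> exists phi,
    [/\ satisfies phi (nth fset0 s i),
        #|` domf phi| <= #|` nth fset0 s i|
      & forall D, width_derivable F k D -> ~ falsifies phi D].
Proof.
move=> [_ s0 sk step] nobot; elim=> [_|i IH lti].
  exists [fmap]; split=> [C|//|D dD fD]; rewrite ?s0 ?inE ?cardfs0 //.
  apply: (nobot D) => //; apply/fsetP => x; rewrite inE; apply/negP => /fD.
  by rewrite /lit_false fnd_fmap0.
have [phi [satG cardG nf]] := IH (ltnW lti).
(* The size bound can be restored afterwards in every case, since shrinking an assignment falsifies
   no new clause. *)
suff [psi [satpsi nfpsi]] : exists psi, satisfies psi (nth fset0 s i.+1) /\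
    forall D, width_derivable F k D -> ~ falsifies psi D.
  have [chi [sub le sat]] := small_satisfying_restriction satpsi.
  by exists chi; split=> // D /nfpsi h fD; apply: h; apply: falsifies_sub fD.
have {step} [ent|[C CF eG]] := step i lti.
  by exists phi; split=> //; apply/apply_eq0P/ent/apply_eq0P.
have [satC|nsat] := boolP (clause_sat phi C).
  exists phi; split=> //; rewrite eG => D /fset1UP[-> //|]; exact: satG.
(* As [C] is new, the next clause-set has one clause more, still at most [k]; this makes the bound
   on [phi] strict. *)
have CG : C \notin nth fset0 s i by apply: contra nsat => /satG.
have ltk : #|` domf phi| < k.
  have := sk _ (mem_nth fset0 lti); rewrite eG cardfsU1 CG add1n.
  exact: leq_ltn_trans.
have [x [xC ux nfx]] := extend_to_satisfy CF ltk nf nsat.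
exists phi.[x.1 <- x.2]; split=> //; rewrite eG => D /fset1UP[->|DG].
  by apply/clause_satP; exists x; rewrite // /lit_true fnd_set eqxx.
apply: clause_sat_sub (satG D DG) => v b; rewrite fnd_set.
by case: eqP => // ->; rewrite ux.
Qed.

End AsymmetricWidth.

Theorem theorem6p3 (V : choiceType) (F : {fset clause V})
  (unsF : unsatisfiable F) : (whd unsF <= ss unsF)%N.
Proof.
rewrite /ss; case: ex_minnP => k /asboolP[s [seqs unsl]] _.
have [C C0 [T [rT lT eT wT]]] :
    exists2 C, lits C = fset0 & width_derivable F k C.
  apply: contrapT => nobot; apply: unsl.
  have [s_gt0 _ _ _] := seqs.
  have [|||phi [satl _ _]] := @semantic_sequence_assignment _ F k s _ _ (size s).-1.
  - exact: seqs.
  - by move=> C C0 dC; apply: nobot; exists C.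
  - by rewrite prednK.
  by exists phi; apply/apply_eq0P; rewrite -nth_last.
(* The derivation of the empty clause is a refutation of width at most [k], and [whd] is the least
   such width. *)
rewrite /whd; case: ex_minnP => m _ min_m.
by apply: leq_trans (min_m _ _) wT; apply/asboolP; exists T => //; split; rewrite ?eT.
Qed.
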